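(* Every $\lambda$-homomorphic skew left brace is meta-trivial.
   Context: A skew left brace is a triple $(G, \cdot, \circ)$ where $(G,\cdot)$ and $(G,\circ)$ are groups and $g_1 \circ (g_2 \cdot g_3) = (g_1 \circ g_2)\cdot g_1^{-1} \cdot (g_1 \circ g_3)$ for all $g_1,g_2,g_3 \in G$, where $g_1^{-1}$ is the inverse in $(G,\cdot)$. For $a \in G$ the map $\lambda_a : b \mapsto a^{-1}\cdot(a \circ b)$ is an automorphism of $(G,\cdot)$, and $a \mapsto \lambda_a$ is a group homomorphism $(G,\circ) \to \operatorname{Aut}(G,\cdot)$. The skew left brace is called $\lambda$-homomorphic if the map $\lambda : (G,\cdot) \to \operatorname{Aut}(G,\cdot)$, $a \mapsto \lambda_a$, is also a group homomorphism. A skew left brace is trivial if the operations $\cdot$ and $\circ$ coincide. A skew left brace $G$ is meta-trivial if there is a trivial sub-skew brace $H$ of $G$ such that the quotient skew brace $G/H$ is (defined and) trivial; here, for the quotient to be defined, $H$ is an ideal, i.e. a normal subgroup of both $(G,\cdot)$ and $(G,\circ)$ with $\lambda_a(H) \subseteq H$ for all $a \in G$, and the operations of $G/H$ are those induced by $\cdot$ and $\circ$. *)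

(* Defs.v *)
From HB Require Import structures.
From mathcomp Require Import all_boot.
From mathcomp Require Import boolp classical_sets.

Set Implicit Arguments.
Unset Strict Implicit.
Unset Printing Implicit Defensive.

Local Open Scope group_scope.
Local Open Scope classical_set_scope.
Local Open Scope quotient_scope.

(* The group structure of [G] is (G, .), written multiplicatively; the mixin
   adds the second group structure (G, ∘), with its own unit and inverse, and the
   brace compatibility law. *)
HB.mixin Record Group_isSkewBrace G of Group G := {
  circ : G -> G -> G;
  circ1 : G;
  circV : G -> G;
  circA : associative circ;
  circ1g : left_id circ1 circ;
  circg1 : right_id circ1 circ;
  circVg : left_inverse circ1 circV circ;
  circgV : right_inverse circ1 circV circ;
  circMr : forall g1 g2 g3 : G,
    circ g1 (g2 * g3) = circ g1 g2 * g1^-1 * circ g1 g3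
}.

#[short(type="skewBraceType")]
HB.structure Definition SkewBrace := {G of Group_isSkewBrace G & Group G}.

Notation "x ∘ y" := (circ x y) (at level 40, left associativity) : group_scope.

(* An alias of the carrier of [G], whose canonical group structure is
   (G, ∘) instead of (G, .). *)
Definition circ_group (G : skewBraceType) : Type := G.
HB.instance Definition _ (G : skewBraceType) := Choice.on (circ_group G).
HB.instance Definition _ (G : skewBraceType) :=
  isGroup.Build (circ_group G) (@circA G) (@circ1g G) (@circg1 G)
    (@circVg G) (@circgV G).

Definition trivial_brace (G : skewBraceType) : Prop :=
  forall a b : G, a * b = a ∘ b.

Definition lambda (G : skewBraceType) (a b : G) : G := a^-1 * (a ∘ b).

Section LambdaTheory.
Variable G : skewBraceType.
Implicit Types a b c : G.

Lemma circE a b : a ∘ b = a * lambda a b.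
Proof. by rewrite /lambda mulgA mulgV mul1g. Qed.

Lemma circ_oneE : circ1 = 1 :> G.
Proof.
have := circMr (circ1 : G) 1 1.
rewrite !circ1g !mul1g mulg1 => e.
by apply: invg_inj; rewrite invg1 -e.
Qed.

Lemma lambdaM a : {morph lambda a : b c / b * c}.
Proof. by move=> b c; rewrite /lambda circMr !mulgA. Qed.

Lemma lambda_circ a b : lambda (a ∘ b) =1 lambda a \o lambda b.
Proof.
move=> c /=; apply: (mulgI (a ∘ b)).
rewrite -circE -circA [b ∘ c]circE circMr -!mulgA; congr (_ * _).
Qed.

Lemma lambda1 : lambda (1 : G) =1 id.
Proof. by move=> b; rewrite /lambda -circ_oneE circ1g circ_oneE invg1 mul1g. Qed.

Lemma lambda_bij a : bijective (lambda a).
Proof.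
exists (lambda (circV a)) => b.
  by rewrite -[LHS]/((lambda _ \o lambda _) b) -lambda_circ circVg circ_oneE lambda1.
by rewrite -[LHS]/((lambda _ \o lambda _) b) -lambda_circ circgV circ_oneE lambda1.
Qed.

End LambdaTheory.

(* The product of Aut(G, .) is composition of maps; [lambda a] is an element of
   Aut(G, .) by [lambdaM] and [lambda_bij]. *)
Definition lambda_homomorphic (G : skewBraceType) : Prop :=
  forall a b : G, lambda (a * b) =1 lambda a \o lambda b.

Record subSkewBrace (G : skewBraceType) := SubSkewBrace {
  subbrace_set :> set G;
  subbrace_mul : group_closed (mem subbrace_set : {pred G});
  subbrace_circ : group_closed (mem subbrace_set : {pred circ_group G})
}.

Definition subbrace_type (G : skewBraceType) (H : subSkewBrace G) : Type :=
  {x : G | x \in (H : set G)}.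

Section SubBrace.
Variables (G : skewBraceType) (H : subSkewBrace G).

HB.instance Definition _ := SubChoice.on (subbrace_type H).
HB.instance Definition _ :=
  SubChoice_isSubGroup.Build G _ (subbrace_type H) (subbrace_mul H).

Let T := subbrace_type H.

Fact sub_circ_subproof (x y : T) : val x ∘ val y \in (H : set G).
Proof. exact: (group_closedM (subbrace_circ H) (valP x) (valP y)). Qed.
Fact sub_circ1_subproof : (circ1 : G) \in (H : set G).
Proof. by case: (subbrace_circ H). Qed.
Fact sub_circV_subproof (x : T) : circV (val x) \in (H : set G).
Proof. exact: (group_closedV (subbrace_circ H) (valP x)). Qed.

Definition sub_circ (x y : T) : T := Sub (val x ∘ val y) (sub_circ_subproof x y).
Definition sub_circ1 : T := Sub circ1 sub_circ1_subproof.
Definition sub_circV (x : T) : T := Sub (circV (val x)) (sub_circV_subproof x).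

Fact sub_circA : associative sub_circ.
Proof. by move=> x y z; apply: val_inj; rewrite !SubK circA. Qed.
Fact sub_circ1g : left_id sub_circ1 sub_circ.
Proof. by move=> x; apply: val_inj; rewrite !SubK circ1g. Qed.
Fact sub_circg1 : right_id sub_circ1 sub_circ.
Proof. by move=> x; apply: val_inj; rewrite !SubK circg1. Qed.
Fact sub_circVg : left_inverse sub_circ1 sub_circV sub_circ.
Proof. by move=> x; apply: val_inj; rewrite !SubK circVg. Qed.
Fact sub_circgV : right_inverse sub_circ1 sub_circV sub_circ.
Proof. by move=> x; apply: val_inj; rewrite !SubK circgV. Qed.
Fact sub_circMr (x y z : T) :
  sub_circ x (y * z) = sub_circ x y * x^-1 * sub_circ x z.
Proof. by apply: val_inj; rewrite SubK !valM /= circMr. Qed.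

HB.instance Definition _ := Group_isSkewBrace.Build (subbrace_type H)
  sub_circA sub_circ1g sub_circg1 sub_circVg sub_circgV sub_circMr.

End SubBrace.

Definition normal_pred (G : groupType) (H : {pred G}) : Prop :=
  forall a, {in H, forall h, h ^ a \in H}.

Record ideal (G : skewBraceType) := Ideal {
  ideal_sub :> subSkewBrace G;
  ideal_normal_mul : normal_pred (mem (ideal_sub : set G) : {pred G});
  ideal_normal_circ : normal_pred (mem (ideal_sub : set G) : {pred circ_group G});
  ideal_lambda : forall a : G, lambda a @` (ideal_sub : set G) `<=` (ideal_sub : set G)
}.

(* G/I is the set of cosets a . I; these are also the cosets a ∘ I, since I is
   invariant under the automorphisms [lambda a]. *)
Definition coset_rel (G : skewBraceType) (I : ideal G) : rel G :=
  fun a b => a^-1 * b \in (I : set G).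

Section Quotient.
Variables (G : skewBraceType) (I : ideal G).
Implicit Types a b c : G.

Let inI a := a \in (I : set G).
Let inI1 : inI 1. Proof. by case: (subbrace_mul I). Qed.
Let inIM a b : inI a -> inI b -> inI (a * b).
Proof. exact: (group_closedM (subbrace_mul I)). Qed.
Let inIV a : inI a -> inI a^-1.
Proof. exact: (group_closedV (subbrace_mul I)). Qed.
Let inIJ a b : inI a -> inI (a ^ b).
Proof. exact: (@ideal_normal_mul G I b a). Qed.
Let inIL a b : inI b -> inI (lambda a b).
Proof. by move=> /set_mem Ib; apply/mem_set/(@ideal_lambda _ I a); exists b. Qed.
Let inIcJ a b : inI a -> inI (circV b ∘ (a ∘ b)).
Proof. exact: (@ideal_normal_circ G I b a). Qed.

Fact coset_refl : reflexive (coset_rel I).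
Proof. by move=> a; rewrite /coset_rel mulVg; exact: inI1. Qed.
Fact coset_sym : symmetric (coset_rel I).
Proof.
have s a b : coset_rel I a b -> coset_rel I b a.
  by move=> /inIV; rewrite /inI invgM invgK.
by move=> a b; apply/idP/idP; exact: s.
Qed.
Fact coset_trans : transitive (coset_rel I).
Proof.
by move=> b a c ab bc; have := inIM ab bc; rewrite /inI mulgA mulgK.
Qed.

Canonical coset_equiv := EquivRel (coset_rel I) coset_refl coset_sym coset_trans.

Definition quotient_brace : Type := {eq_quot (coset_rel I)}.
HB.instance Definition _ := Choice.on quotient_brace.
HB.instance Definition _ := EqQuotient.on quotient_brace.

Let Q := quotient_brace.

Definition quo_mul : Q -> Q -> Q := lift_op2 Q (fun a b => a * b).
Definition quo_one : Q := lift_cst Q 1.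
Definition quo_inv : Q -> Q := lift_op1 Q (fun a => a^-1).
Definition quo_circ : Q -> Q -> Q := lift_op2 Q (fun a b => a ∘ b).
Definition quo_circ1 : Q := lift_cst Q circ1.
Definition quo_circV : Q -> Q := lift_op1 Q (fun a => circV a).

Let piP a b : reflect (\pi_Q a = \pi_Q b) (inI (a^-1 * b)).
Proof. exact: (iffP (eqmodP (coset_equiv) a b)). Qed.

Fact pi_mul : {morph \pi_Q : a b / a * b >-> quo_mul a b}.
Proof.
move=> a b; unlock quo_mul; apply/piP.
have /piP ha := esym (reprK (\pi_Q a)); have /piP hb := esym (reprK (\pi_Q b)).
set a' := repr _ in ha *; set b' := repr _ in hb *.
have := inIM (inIJ b ha) hb; congr inI.
by rewrite /conjg invgM !mulgA mulgK.
Qed.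

Fact pi_circ : {morph \pi_Q : a b / a ∘ b >-> quo_circ a b}.
Proof.
move=> a b; unlock quo_circ.
have /piP ha := esym (reprK (\pi_Q a)); have /piP hb := esym (reprK (\pi_Q b)).
set a' := repr _ in ha *; set b' := repr _ in hb *.
have circ_shift (x k : G) : inI k -> \pi_Q x = \pi_Q (x ∘ k).
  by move=> Ik; apply/piP; exact: inIL.
transitivity (\pi_Q (a ∘ b')).
  have -> : b' = b ∘ lambda (circV b) (b^-1 * b').
    rewrite circE -[lambda b _]/((lambda b \o lambda _) _) -lambda_circ.
    by rewrite circgV circ_oneE lambda1 mulgA mulgV mul1g.
  by rewrite circA; apply/circ_shift/inIL.
have -> : a' = a ∘ lambda (circV a) (a^-1 * a').
  rewrite circE -[lambda a _]/((lambda a \o lambda _) _) -lambda_circ.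
  by rewrite circgV circ_oneE lambda1 mulgA mulgV mul1g.
set k := lambda _ _; have Ik : inI k by exact: inIL.
have -> : a ∘ k ∘ b' = a ∘ b' ∘ (circV b' ∘ (k ∘ b')).
  by rewrite -!circA (circA b') circgV circ1g.
exact/circ_shift/inIcJ.
Qed.

Fact quo_mulA : associative quo_mul.
Proof. by move=> x y z; rewrite -(reprK x) -(reprK y) -(reprK z) -!pi_mul mulgA. Qed.
Fact quo_mul1g : left_id quo_one quo_mul.
Proof. by move=> x; unlock quo_one; rewrite -(reprK x) -pi_mul mul1g. Qed.
Fact quo_mulg1 : right_id quo_one quo_mul.
Proof. by move=> x; unlock quo_one; rewrite -(reprK x) -pi_mul mulg1. Qed.
Fact quo_mulVg : left_inverse quo_one quo_inv quo_mul.
Proof.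
by move=> x; unlock quo_one quo_inv; rewrite -{2}(reprK x) -pi_mul mulVg. Qed.
Fact quo_mulgV : right_inverse quo_one quo_inv quo_mul.
Proof.
by move=> x; unlock quo_one quo_inv; rewrite -{1}(reprK x) -pi_mul mulgV. Qed.

HB.instance Definition _ := isGroup.Build quotient_brace
  quo_mulA quo_mul1g quo_mulg1 quo_mulVg quo_mulgV.

Fact quo_circA : associative quo_circ.
Proof.
by move=> x y z; rewrite -(reprK x) -(reprK y) -(reprK z) -!pi_circ circA.
Qed.
Fact quo_circ1g : left_id quo_circ1 quo_circ.
Proof. by move=> x; unlock quo_circ1; rewrite -(reprK x) -pi_circ circ1g. Qed.
Fact quo_circg1 : right_id quo_circ1 quo_circ.
Proof. by move=> x; unlock quo_circ1; rewrite -(reprK x) -pi_circ circg1. Qed.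
Fact quo_circVg : left_inverse quo_circ1 quo_circV quo_circ.
Proof.
by move=> x; unlock quo_circ1 quo_circV; rewrite -{2}(reprK x) -pi_circ circVg. Qed.
Fact quo_circgV : right_inverse quo_circ1 quo_circV quo_circ.
Proof.
by move=> x; unlock quo_circ1 quo_circV; rewrite -{1}(reprK x) -pi_circ circgV. Qed.
Fact quo_circMr (x y z : Q) :
  quo_circ x (y * z) = quo_circ x y * x^-1 * quo_circ x z.
Proof.
rewrite -[_ * z]/(quo_mul y z) -[RHS]/(quo_mul (quo_mul _ (quo_inv x)) _).
unlock quo_inv; rewrite -{1 2 4}(reprK x) -(reprK y) -(reprK z).
by rewrite -!(pi_mul, pi_circ) circMr.
Qed.

HB.instance Definition _ := Group_isSkewBrace.Build quotient_brace
  quo_circA quo_circ1g quo_circg1 quo_circVg quo_circgV quo_circMr.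

End Quotient.

Definition meta_trivial (G : skewBraceType) : Prop :=
  exists I : ideal G,
    trivial_brace (subbrace_type I) /\ trivial_brace (quotient_brace I).

(* Main.v *)
(** The ideal is the kernel K of λ : (G, .) -> Aut(G, .). Since λ is a morphism
   for both operations, a . b and a ∘ b have the same image under λ, so they are
   congruent modulo K and G/K is trivial; and K is trivial because
   a ∘ b = a . λ_a(b) = a . b for a in K. *)
Require Import Defs.
From HB Require Import structures.
From mathcomp Require Import all_boot.
From mathcomp Require Import boolp classical_sets.

Local Open Scope group_scope.
Local Open Scope classical_set_scope.

Section LambdaKernel.
Variable G : skewBraceType.
Implicit Types a b c : G.

Definition lambda_ker : set G := [set a | lambda a =1 id].

Lemma lambda_kerP a : reflect (lambda a =1 id) (a \in lambda_ker).
Proof. by apply: (iffP idP) => [/set_mem|/mem_set]. Qed.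

(** λ is a morphism on (G, ∘), so the ∘-inverse of a acts as the inverse of λ_a. *)
Lemma lambda_circVK a : cancel (lambda a) (lambda (circV a)).
Proof.
move=> b; rewrite -[LHS]/((lambda _ \o lambda _) b) -lambda_circ circVg.
by rewrite circ_oneE lambda1.
Qed.

Fact lambda_ker_circ_closed : group_closed (mem lambda_ker : {pred circ_group G}).
Proof.
(* The unit here is that of [circ_group G], namely [circ1]. *)
split; first by apply/lambda_kerP => x; rewrite [1]circ_oneE lambda1.
move=> a b /lambda_kerP ha /lambda_kerP hb; apply/lambda_kerP => x.
rewrite [LHS](lambda_circ a (circV b)) /= ha.
(* Since λ_b fixes x, write x as λ_b(x), so that λ at the ∘-inverse of b cancels it. *)
by rewrite -[in LHS](hb x) lambda_circVK.
Qed.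

Fact lambda_ker_circ_normal : normal_pred (mem lambda_ker : {pred circ_group G}).
Proof.
move=> a h /lambda_kerP hh; apply/lambda_kerP => x.
(* A conjugate in [circ_group G] is by conversion the ∘-product [circV a ∘ (h ∘ a)]. *)
rewrite [LHS](lambda_circ (circV a) (h ∘ a)) /= lambda_circ /= hh.
exact: lambda_circVK.
Qed.

Hypothesis lambda_hom : lambda_homomorphic G.

(** Counterpart of [lambda_circVK] for the other group law: λ-homomorphy gives λ_(a^-1) λ_a = λ_1 =
    id. *)
Lemma lambdaVK a : cancel (lambda a) (lambda a^-1).
Proof.
by move=> b; rewrite -[LHS]/((lambda _ \o lambda _) b) -lambda_hom mulVg lambda1.
Qed.

Fact lambda_ker_mul_closed : group_closed (mem lambda_ker : {pred G}).
Proof.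
split; first by apply/lambda_kerP => x; rewrite lambda1.
move=> a b /lambda_kerP ha /lambda_kerP hb; apply/lambda_kerP => x.
by rewrite lambda_hom /= ha -[in LHS](hb x) lambdaVK.
Qed.

Fact lambda_ker_mul_normal : normal_pred (mem lambda_ker : {pred G}).
Proof.
move=> a h /lambda_kerP hh; apply/lambda_kerP => x.
by rewrite /conjg !lambda_hom /= lambda_hom /= hh lambdaVK.
Qed.

(* λ_a λ_k = λ_(a ∘ k) = λ_(a . λ_a(k)) = λ_a λ_(λ_a(k)), and λ_a is injective. *)
Fact lambda_ker_lambda a : lambda a @` lambda_ker `<=` lambda_ker.
Proof.
move=> _ [k hk <-] x; apply: (bij_inj (lambda_bij a)).
rewrite -[LHS]/((lambda _ \o lambda _) x) -lambda_hom -circE lambda_circ /=.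
by rewrite hk.
Qed.

Definition lambda_ker_ideal : ideal G :=
  @Ideal G (SubSkewBrace lambda_ker_mul_closed lambda_ker_circ_closed)
    lambda_ker_mul_normal lambda_ker_circ_normal lambda_ker_lambda.

Lemma lambda_ker_trivial : trivial_brace (subbrace_type lambda_ker_ideal).
Proof.
move=> a b; apply: val_inj; rewrite valM SubK circE.
by have /lambda_kerP -> := valP a.
Qed.

Lemma lambda_ker_quotient_trivial : trivial_brace (quotient_brace lambda_ker_ideal).
Proof.
move=> x y; rewrite -(reprK x) -(reprK y).
rewrite -[LHS]pi_mul -[RHS]pi_circ.
set a := repr x; set b := repr y.
(* It remains that (a . b)^-1 . (a ∘ b) lies in K; this follows from λ_(a ∘ b) = λ_a λ_b = λ_(a .
   b). *)
apply/(eqmodP (coset_equiv lambda_ker_ideal))/lambda_kerP => z.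
by rewrite lambda_hom /= lambda_circ -lambda_hom lambdaVK.
Qed.

End LambdaKernel.

Theorem theorem2p12 (G : skewBraceType) :
  lambda_homomorphic G -> meta_trivial G.
Proof.
move=> lambda_hom; exists (lambda_ker_ideal _ lambda_hom); split.
  exact: lambda_ker_trivial.
exact: lambda_ker_quotient_trivial.
Qed.
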